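(* Let $G$ be a finite connected simple graph without isolated vertices on the vertex set $V(G)=[n]=\{1,\dots,n\}$. For $j\in V(G)$ set $$N_G^{<}(j)=\{i : \{i,j\}\in E(G),\ i<j\},\qquad N_G^{>}(j)=\{k : \{j,k\}\in E(G),\ j<k\}.$$ The following conditions are equivalent: (1) $G$ is closed with respect to the given order of the vertices; (2) for all vertices $j\in V(G)$ the sets $N_G^{<}(j)$ and $N_G^{>}(j)$ are cliques of $G$.
   Context: A subset $C\subseteq[n]$ is a clique of $G$ if $\{i,j\}\in E(G)$ for all $i,j\in C$ with $i\ne j$ (in particular the empty set and singletons are cliques). $G$ is closed with respect to the given order (labelling) of the vertices if for all distinct edges $\{i,j\},\{k,\ell\}\in E(G)$ with $i<j$ and $k<\ell$ one has $\{j,\ell\}\in E(G)$ if $i=k$, and $\{i,k\}\in E(G)$ if $j=\ell$. *)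

(* Defs.v *)
From mathcomp Require Import all_boot.
Set Implicit Arguments.
Unset Strict Implicit.
Unset Printing Implicit Defensive.

(* The vertex set [n] is represented by 'I_n, i.e. shifted to {0, ..., n-1};
   the vertex order is the order of the underlying naturals. *)
Record sgraph (n : nat) := SGraph {
  adj :> rel 'I_n;
  adj_sym : symmetric adj;
  adj_irr : irreflexive adj }.

Definition connected_graph (n : nat) (G : sgraph n) : Prop :=
  forall i j : 'I_n, connect G i j.

Definition no_isolated_vertex (n : nat) (G : sgraph n) : Prop :=
  forall i : 'I_n, exists j : 'I_n, G i j.

Definition clique (n : nat) (G : sgraph n) (C : {set 'I_n}) : Prop :=
  forall i j : 'I_n, i \in C -> j \in C -> i != j -> G i j.

Definition closed_graph (n : nat) (G : sgraph n) : Prop :=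
  forall i j k l : 'I_n,
    G i j -> G k l -> [set i; j] != [set k; l] -> i < j -> k < l ->
    (i = k -> G j l) /\ (j = l -> G i k).

Definition nbr_lt (n : nat) (G : sgraph n) (j : 'I_n) : {set 'I_n} :=
  [set i | G i j & i < j].

Definition nbr_gt (n : nat) (G : sgraph n) (j : 'I_n) : {set 'I_n} :=
  [set k | G j k & j < k].

(* Main.v *)
Require Import Defs.
From mathcomp Require Import all_boot.

(** Two edges with the same larger endpoint [j] are two elements of [nbr_lt G j]; with the same
    smaller endpoint, two elements of [nbr_gt G j]. So closedness is the clique condition read one
    shared vertex at a time. It remains to match distinct edges with distinct free endpoints, for
    which [set2_injl] is used. *)

Lemma set2_injl (T : finType) (a b c : T) : [set a; b] = [set a; c] -> b = c.
Proof.
move=> eq_set.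
have := set22 a b; rewrite eq_set => /set2P[ba|//].
(* If [b = a], the common set collapses to the singleton of [a], which contains [c]. *)
by have := set22 a c; rewrite -eq_set ba => /set2P[] ->.
Qed.

Theorem proposition3p6 (n : nat) (G : sgraph n)
    (Gconn : connected_graph G) (Gniso : no_isolated_vertex G) :
  closed_graph G <->
  (forall j : 'I_n, clique G (nbr_lt G j) /\ clique G (nbr_gt G j)).
Proof.
split=> [Gclosed j | Gcliques i j k l Gij Gkl neq_edges ij kl].
- split=> a b; rewrite !inE => /andP[Ga lt_a] /andP[Gb lt_b] neq_ab.
  + apply: (proj2 (Gclosed a j b j Ga Gb _ lt_a lt_b)) => //.
    (* The shared endpoint [j] comes second here, so both pairs are swapped before cancelling it. *)
    apply: contra neq_ab => /eqP; rewrite ![[set _; j]]setUC.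
    by move=> /set2_injl ->.
  + apply: (proj1 (Gclosed j a j b Ga Gb _ lt_a lt_b)) => //.
    by apply: contra neq_ab => /eqP/set2_injl ->.
- split=> [eq_ik | eq_jl]; subst.
  + apply: (proj2 (Gcliques k)); rewrite ?inE ?Gij ?Gkl //.
    by apply: contra neq_edges => /eqP ->.
  + apply: (proj1 (Gcliques l)); rewrite ?inE ?Gij ?Gkl //.
    by apply: contra neq_edges => /eqP ->.
Qed.
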